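(* Let $f:\mathbb{R}^d\to\mathbb{R}$ be twice continuously differentiable, let $y^*$ be any (local) maximizer of $f$, and suppose there exist positive numbers $R,m,M,L_f$ such that: 1. $|f(x_1)-f(x_2)|\le L_f\|x_1-x_2\|$ for all $x_1,x_2\in\mathbb{R}^d$; 2. $v^{\top}\nabla^2 f(x)v<-m\|v\|^2$ for all nonzero $v\in\mathbb{R}^d$ and all $x\in B_R(y^* )$; 3. $f(x)<M$ for all $x\in\mathbb{R}^d$; 4. $\|\nabla^2 f(x)\|<M$ for all $x\in\mathbb{R}^d$, where $\|\nabla^2 f(x)\|:=\max_{\|v\|=1}\|\nabla^2 f(x)v\|$ is the spectral norm. Then for any $N>0$: (a) There exists $R_1\in(0,R)$ such that $\sup_{\|x-y^*\|<R_1}\|\nabla f(x)\|<\sqrt{m/(2N)}$. (b) For such an $R_1$ and for any $r\in(0,R_1/2)$, $F_{N,\sigma}$ has a unique maximizer $z^*$ in $B_r(y^* )$, in the sense that $F_{N,\sigma}(z^* )>F_{N,\sigma}(x)$ for every $x\in B_r(y^* )$ with $x\ne z^*$, provided that $$0<\sigma<\min\left\{\frac{R_1}{2\sqrt d+2\sqrt{2\log\big((m_1+M_1)/m_1\big)}},\ \frac{\Delta_r}{2e^{NM}NL_f\,\mathbb{E}_{\epsilon\sim\mathcal{N}(0,I_d)}\|\epsilon\|}\right\},$$ where $m_1:=Ne^{Nf_c}(m/2)>0$, $f_c$ is a lower bound of $f$ on the closed ball $\overline{B_{R_1}(y^* )}$, $M_1:=N^2e^{NM}L_f^2+Ne^{NM}M$,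 and $\Delta_r:=f_N(y^* )-\max_{x\in\partial B_r(y^* )}f_N(x)>0$.
   Context: $\|\cdot\|$ is the Euclidean norm on vectors; $B_\rho(y)=\{z\in\mathbb{R}^d:\|z-y\|<\rho\}$ and $\partial B_\rho(y)=\{z:\|z-y\|=\rho\}$. For $N>0$, $\sigma>0$, $f_N(x)=e^{Nf(x)}$ and $F_{N,\sigma}(\mu)=\mathbb{E}_{x\sim\mathcal{N}(\mu,\sigma^2I_d)}[f_N(x)]$ for $\mu\in\mathbb{R}^d$. *)

(* Defs.v *)
From HB Require Import structures.
From mathcomp Require Import all_boot all_order all_algebra.
From mathcomp Require Import all_classical all_reals all_analysis.

Set Implicit Arguments.
Unset Strict Implicit.
Unset Printing Implicit Defensive.

Import Order.TTheory GRing.Theory Num.Def Num.Theory.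
Import numFieldNormedType.Exports.

Local Open Scope classical_set_scope.
Local Open Scope ring_scope.

(* Points of R^d are row vectors.  The library norm `|v| on 'rV[R]_d is the
   sup norm, so the Euclidean norm is defined here; both induce the same
   topology, hence the same neighborhoods, derivatives and continuity. *)
Section euclidean.
Context {R : realType} {d : nat}.
Implicit Types (v x y : 'rV[R]_d) (r : R).

Definition enorm v : R := Num.sqrt (\sum_i v 0 i ^+ 2).
Definition eball y r : set 'rV[R]_d := [set z | enorm (z - y) < r].
Definition ecball y r : set 'rV[R]_d := [set z | enorm (z - y) <= r].
Definition esphere y r : set 'rV[R]_d := [set z | enorm (z - y) = r].

(* v *m A^T is the row vector of the column A v.  For 0 < d this supremum is
   taken over a nonempty compact set, so it is a maximum. *)
Definition spectral_norm (A : 'M[R]_d) : R :=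
  sup [set enorm (v *m A^T) | v in [set v | enorm v = 1]].

Definition grad (f : 'rV[R]_d -> R) x : 'rV[R]_d :=
  \row_i 'D_(delta_mx 0 i) f x.

(* Entry (i, j) is the i-th partial derivative of the j-th partial derivative
   of f: the library jacobian acts on row vectors by right multiplication. *)
Definition hess (f : 'rV[R]_d -> R) x : 'M[R]_d := 'J (grad f) x.

Definition twice_cont_diff (f : 'rV[R]_d -> R) : Prop :=
  [/\ forall x, differentiable f x,
      forall x, differentiable (grad f) x
    & continuous (hess f)].

End euclidean.

Section tuple_product.
Context d (T : measurableType d) (R : realType).

Definition tcons n (p : T * n.-tuple T) : n.+1.-tuple T :=
  [the n.+1.-tuple T of p.1 :: p.2].

Lemma measurable_tcons n : measurable_fun [set: T * n.-tuple T] (@tcons n).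
Proof. exact: (measurable_cons measurable_fst measurable_snd). Qed.

HB.instance Definition _ n :=
  isMeasurableFun.Build _ _ _ _ (@tcons n) (@measurable_tcons n).

Fixpoint tuple_prob n : ('I_n -> probability T R) -> probability (n.-tuple T) R :=
  match n with
  | 0 => fun=> \d_([tuple] : 0.-tuple T)
  | n.+1 => fun P =>
      distribution (P ord0 \x tuple_prob (fun i => P (lift ord0 i)))%E (@tcons n)
  end.

Lemma tuple_prob_box n (P : 'I_n -> probability T R) (A : 'I_n -> set T) :
  (forall i, measurable (A i)) ->
  tuple_prob P [set t | forall i, A i (tnth t i)] = (\prod_i P i (A i))%E.
Proof.
elim: n P A => [|n IH] P A mA.
  by rewrite big_ord0 /= diracE mem_set// => -[].
rewrite big_ord_recl /= /distribution /pushforward -IH//.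
set B := [set t : n.-tuple T | _].
have mB : measurable B.
  have -> : B = \bigcap_(i in [set: 'I_n]) (fun t => tnth t i) @^-1` A (lift ord0 i).
    by apply/seteqP; split=> [t Bt i _|t Bt i]; [exact: Bt|exact: Bt].
  apply: fin_bigcap_measurable => // i _.
  by rewrite -[X in measurable X]setTI; exact: measurable_tnth.
rewrite -product_measure1E//; congr ((_ \x _)%E _).
apply/seteqP; split=> [[x t]/= H|[x t]/= [Ax Bt] i].
  split; first by have := H ord0; rewrite tnth0.
  by move=> i; have := H (lift ord0 i); rewrite tnthS.
by case: (unliftP ord0 i) => [j|] ->; [rewrite tnthS; exact: Bt|rewrite tnth0].
Qed.

End tuple_product.

Section gaussian.
Context {R : realType} {d : nat}.
Implicit Types (mu : 'rV[R]_d) (sigma : R).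

(* N(mu, sigma^2 I_d): independent coordinates, the i-th one being
   N(mu_i, sigma^2).  The library parameter of normal_prob is the standard
   deviation, and normal_prob is the Gaussian law only for sigma != 0. *)
Definition gauss mu sigma : 
  probability (d.-tuple (measurableTypeR R)) R :=
  tuple_prob (fun i : 'I_d => normal_prob (mu 0 i) sigma).

Definition gauss_expectation mu sigma (g : 'rV[R]_d -> R) : R :=
  fine 'E_(gauss mu sigma) [fun t => g (\row_i tnth t i)].

Definition fpow (N : R) (f : 'rV[R]_d -> R) x : R := expR (N * f x).

Definition Fsmooth (N sigma : R) (f : 'rV[R]_d -> R) mu : R :=
  gauss_expectation mu sigma (fpow N f).

End gaussian.

(* Main.v *)
Require Import Defs.
From HB Require Import structures.
From mathcomp Require Import all_boot all_order all_algebra.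
From mathcomp Require Import all_classical all_reals all_analysis.
From mathcomp Require Import measurable_realfun ring lra.

(* Each translate of f_N by a noise vector w is treated separately. On the
   segment from x to x + v, the second derivative of s |-> f_N (x + s v + w) is
   at most - m1 |v|^2 when |w| < R1 / 2 and at most M1 |v|^2 always, so its
   midpoint defect is at least m1 |v|^2 / 8, respectively - M1 |v|^2 / 8.
   Averaging these bounds over w makes F_{N,sigma} strictly midpoint concave on
   the ball as soon as P(|w| >= R1 / 2) < m1 / (m1 + M1): the integral is never
   differentiated. That probability bound is the Gaussian tail estimate
   P(|eps| >= a) <= exp (- (a - sqrt d)^2 / 2), a Chernoff bound with the
   exponent optimized. A maximizer exists on the closed ball by compactness, and
   |F_{N,sigma} - f_N| < Delta / 2 keeps it away from the sphere; midpoint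
   concavity makes it unique. *)

Set Implicit Arguments.
Unset Strict Implicit.
Unset Printing Implicit Defensive.

Import Order.TTheory GRing.Theory Num.Def Num.Theory.
Import numFieldNormedType.Exports.

Local Open Scope classical_set_scope.
Local Open Scope ring_scope.

(** * Gaussian measures *)

Section normal_prob_integral.
Context {R : realType}.
Implicit Types (m s x : R) (f : measurableTypeR R -> \bar R).
Local Notation mu := (@lebesgue_measure R).
Local Notation nu m s := (normal_prob m s : probability (measurableTypeR R) R).

(** The Radon-Nikodym derivative of the normal law and [normal_pdf] have the same integral over
    every measurable set, so they agree almost everywhere. *)
Lemma ge0_integral_normal_prob m s f :
  measurable_fun [set: measurableTypeR R] f -> (forall x, (0 <= f x)%E) ->
  (\int[nu m s]_x f x = \int[mu]_x (f x * (normal_pdf m s x)%:E))%E.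
Proof.
move=> mf f0; have dom := normal_prob_dominates m s.
rewrite -(Radon_Nikodym_SigmaFinite.change_of_variables dom f0)//.
have mRN : measurable_fun [set: R]
    (Radon_Nikodym_SigmaFinite.f (normal_prob m s) mu).
  exact: measurable_int (Radon_Nikodym_SigmaFinite.f_integrable dom).
have mpdf : measurable_fun [set: R] (fun x => (normal_pdf m s x)%:E).
  by apply/measurable_EFinP; exact: measurable_normal_pdf.
apply: ae_eq_integral => //; do ?exact: emeasurable_funM.
apply: ae_eqe_mul2l; apply: integral_ae_eq => //.
  exact: Radon_Nikodym_SigmaFinite.f_integrable.
by move=> E _ mE; rewrite -(Radon_Nikodym_SigmaFinite.f_integral dom).
Qed.

(** The right-hand side is a scaled pushforward measure that gives intervals []a, b]] their length;
    uniqueness of Lebesgue measure concludes. *)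
Lemma lebesgue_measure_affine m s (s_gt0 : 0 < s) (A : set R) : measurable A ->
  mu A = (s%:E * mu ((fun x => m + s * x)%R @^-1` A))%E.
Proof.
move=> mA; pose h : measurableTypeR R -> measurableTypeR R := fun x => m + s * x.
have mh : measurable_fun [set: measurableTypeR R] h.
  by apply: measurable_funD => //; exact: measurable_funM.
rewrite -[RHS]/(pushforward (mscale (NngNum (ltW s_gt0)) mu) h A).
apply: lebesgue_measure_unique => // _ [[a b]] _ <-.
rewrite -[RHS]/(s%:E * mu (h @^-1` [set` `]a, b]]))%E.
have -> : h @^-1` [set` `]a, b]] = [set` `](a - m) / s, (b - m) / s]].
  apply/seteqP; split => x /=; rewrite !in_itv/= ltr_pdivrMr// ler_pdivlMr// /h;
  by rewrite ltrBlDl lerBrDl mulrC.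
rewrite !lebesgue_measure_itv/= !lte_fin ltr_pM2r ?invr_gt0// ltrD2r.
case: ifPn => _; last by rewrite mule0.
by rewrite -!EFinD -EFinM; congr EFin; field; lra.
Qed.

Lemma normal_prob_affine m s (s_gt0 : 0 < s) (A : set R) : measurable A ->
  normal_prob m s A = normal_prob 0 1 ((fun x => m + s * x) @^-1` A).
Proof.
move=> mA; pose h : measurableTypeR R -> measurableTypeR R := fun x => m + s * x.
have mh : measurable_fun [set: measurableTypeR R] h.
  by apply: measurable_funD => //; exact: measurable_funM.
rewrite /normal_prob.
have mpdf (a b : R) (D : set (measurableTypeR R)) :
    measurable_fun D (fun x => (normal_pdf a b x)%:E).
  by apply/measurable_EFinP/measurable_funTS; exact: measurable_normal_pdf.
have mhA : @measurable _ (measurableTypeR R) (h @^-1` A).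
  by rewrite -[X in measurable X]setTI; exact: mh.
have mpdfh : measurable_fun (h @^-1` A) (fun x => (normal_pdf m s (h x))%:E).
  apply: measurable_funTS.
  exact: measurableT_comp (mpdf m s setT) mh.
(* Substituting u = m + s x, the Jacobian s cancels the factor 1 / s in the peak of the density. *)
rewrite (eq_measure_integral (pushforward (mscale (NngNum (ltW s_gt0)) mu) h)).
  rewrite ge0_integral_pushforward//; last first.
    by move=> x _; rewrite lee_fin normal_pdf_ge0.
  rewrite ge0_integral_mscale//; last by move=> x _; rewrite lee_fin normal_pdf_ge0.
  rewrite -ge0_integralZl//=.
  - apply: eq_integral => x _; rewrite -EFinM; congr EFin.
    rewrite !normal_pdfE ?gt_eqF// /normal_peak /normal_fun /h.
    have -> : s ^+ 2 * pi *+ 2 = s ^+ 2 * (1 ^+ 2 * pi *+ 2).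
      by rewrite expr1n mul1r mulrnAr.
    rewrite sqrtrM ?sqr_ge0// sqrtr_sqr gtr0_norm// invfM.
    rewrite mulrA mulrA divff ?gt_eqF// mul1r; congr (_ * expR _).
    by field; lra.
  - by move=> x _; rewrite lee_fin normal_pdf_ge0.
  - by rewrite lee_fin ltW.
by move=> B mB BA; exact: (lebesgue_measure_affine m).
Qed.

End normal_prob_integral.

(** * Integration against finite products of probabilities *)

Section tuple_prob_integral.
Local Open Scope ereal_scope.
Context {R : realType}.

Lemma ge0_integral_tuple_probS d (T : measurableType d) n
    (P : 'I_n.+1 -> probability T R) (g : n.+1.-tuple T -> \bar R) :
  measurable_fun [set: n.+1.-tuple T] g -> (forall t, 0 <= g t) ->
  \int[tuple_prob P]_t g t =
  \int[P ord0]_x \int[tuple_prob (fun i => P (lift ord0 i))]_t g (tcons (x, t)).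
Proof.
move=> mg g0; rewrite ge0_integral_distribution// fubini_tonelli1//.
  exact: measurableT_comp.
by move=> x /=.
Qed.

(** Change of variables in each coordinate separately; it will carry N(mu, sigma^2 I) to the
    standard Gaussian. *)
Lemma ge0_integral_tuple_prob_map d d' (T : measurableType d)
    (T' : measurableType d') n (P : 'I_n -> probability T' R)
    (Q : 'I_n -> probability T R) (h : 'I_n -> T -> T')
    (g : n.-tuple T' -> \bar R) :
  (forall i, measurable_fun [set: T] (h i)) ->
  (forall i A, measurable A -> P i A = Q i (h i @^-1` A)) ->
  measurable_fun [set: n.-tuple T'] g -> (forall t, 0 <= g t) ->
  \int[tuple_prob P]_t g t =
  \int[tuple_prob Q]_t g [tuple h i (tnth t i) | i < n].
Proof.
have mmap m (h' : 'I_m -> T -> T') : (forall i, measurable_fun [set: T] (h' i)) ->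
    measurable_fun [set: m.-tuple T] (fun t => [tuple h' i (tnth t i) | i < m]).
  move=> mh'; apply/measurable_fun_tnthP => i.
  rewrite [X in measurable_fun _ X](_ : _ = h' i \o (fun t => tnth t i)).
    by apply: measurableT_comp => //; exact: measurable_tnth.
  by apply/funext => t /=; rewrite tnth_mktuple.
elim: n P Q h g => [|n IH] P Q h g mh PQ mg g0.
  rewrite /= !integral_dirac//; last first.
    by apply: measurableT_comp => //; exact: mmap.
  by rewrite !probability_setT !mul1e; congr g; rewrite [RHS]tuple0.
have mgc (x : T') : measurable_fun [set: n.-tuple T'] (fun t => g (tcons (x, t))).
  by do 2 apply: measurableT_comp => //.
rewrite !ge0_integral_tuple_probS//; last first.
  by apply: measurableT_comp => //; exact: mmap.
pose tail := fun t : n.-tuple T => [tuple h (lift ord0 i) (tnth t i) | i < n].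
(* The tail is transported first, with the head x fixed, by induction; the head then follows by a
   pushforward. *)
transitivity (\int[P ord0]_x \int[tuple_prob (fun i => Q (lift ord0 i))]_t
    g (tcons (x, tail t))).
  apply: eq_integral => x _.
  by apply: (IH _ _ (fun i => h (lift ord0 i)) (fun t => g (tcons (x, t)))) => // i A;
    exact: PQ.
have mtail : measurable_fun [set: n.-tuple T] tail.
  exact: (mmap _ _ (fun i => mh (lift ord0 i))).
pose k (p : T' * n.-tuple T) := g (tcons (p.1, tail p.2)).
have mk : measurable_fun setT k.
  do 2 apply: measurableT_comp => //; apply: measurable_fun_pair => //.
  exact: measurableT_comp mtail measurable_snd.
have mG := measurable_fun_fubini_tonelli_F
  (m2 := tuple_prob (fun i => Q (lift ord0 i))) k mk (fun p => g0 _).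
rewrite (eq_measure_integral (pushforward (Q ord0) (h ord0))); last first.
  by move=> A mA _; exact: PQ.
rewrite ge0_integral_pushforward//; last first.
  by move=> x _; apply: integral_ge0 => t _.
apply: eq_integral => x _; apply: eq_integral => t _ /=.
congr g; apply: eq_from_tnth => i; rewrite tnth_mktuple.
by have [j|] := unliftP ord0 i; move=> ->; rewrite ?tnth0 // !tnthS tnth_mktuple.
Qed.

(** Independence of the coordinates, by Tonelli and induction; it factors the exponential moment in
    the tail estimate. *)
Lemma integral_tuple_prob_prod d (T : measurableType d) n
    (P : 'I_n -> probability T R) (g : 'I_n -> T -> R) :
  (forall i, measurable_fun [set: T] (g i)) -> (forall i x, (0 <= g i x)%R) ->
  \int[tuple_prob P]_t (\prod_i g i (tnth t i))%:E =
  \prod_i \int[P i]_x (g i x)%:E.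
Proof.
have mprod m (g' : 'I_m -> T -> R) : (forall i, measurable_fun [set: T] (g' i)) ->
    measurable_fun [set: m.-tuple T] (fun t => (\prod_i g' i (tnth t i))%:E).
  move=> mg'; apply/measurable_EFinP; apply: measurable_prod => i _.
  by apply: measurableT_comp => //; exact: measurable_tnth.
elim: n P g => [|n IH] P g mg g0.
  rewrite /= integral_dirac//; last exact: mprod.
  by rewrite probability_setT mul1e !big_ord0.
rewrite ge0_integral_tuple_probS//; last 2 first.
  exact: mprod.
  by move=> t; rewrite lee_fin; apply: prodr_ge0.
rewrite big_ord_recl -IH//.
transitivity (\int[P ord0]_x ((g ord0 x)%:E *
    \int[tuple_prob (fun i => P (lift ord0 i))]_t
      (\prod_i g (lift ord0 i) (tnth t i))%:E)).
  apply: eq_integral => x _; rewrite -ge0_integralZl//=.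
  - apply: eq_integral => t _; rewrite big_ord_recl tnth0 EFinM.
    by congr (_ * _%:E); apply: eq_bigr => i _; rewrite tnthS.
  - exact: (mprod _ (fun i => g (lift ord0 i)) (fun i => mg _)).
  - by move=> t _; rewrite lee_fin; apply: prodr_ge0.
  - by rewrite lee_fin.
rewrite ge0_integralZr//.
- exact/measurable_EFinP.
- by move=> x _; rewrite lee_fin.
- by apply: integral_ge0 => t _; rewrite lee_fin; apply: prodr_ge0.
Qed.

End tuple_prob_integral.

(** * The Euclidean norm *)

Section euclidean_norm.
Context {R : realType} {d : nat}.
Implicit Types (u v w x y : 'rV[R]_d).

Definition dotr u v : R := \sum_i u 0 i * v 0 i.

Lemma dotrE u v : dotr u v = (u *m v^T) 0 0.
Proof. by rewrite mxE; apply: eq_bigr => i _; rewrite mxE. Qed.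

Lemma enorm_ge0 v : 0 <= enorm v. Proof. exact: sqrtr_ge0. Qed.

Lemma enorm_sqr v : enorm v ^+ 2 = dotr v v.
Proof.
rewrite sqr_sqrtr; last by apply: sumr_ge0 => i _; exact: sqr_ge0.
by apply: eq_bigr => i _; rewrite expr2.
Qed.

Lemma enorm0 : enorm (0 : 'rV[R]_d) = 0.
Proof. by rewrite /enorm big1 ?sqrtr0// => i _; rewrite mxE expr0n. Qed.

Lemma enormZ (a : R) v : enorm (a *: v) = `|a| * enorm v.
Proof.
rewrite -[`|a|]sqrtr_sqr -sqrtrM ?sqr_ge0// mulr_sumr.
by congr sqrtr; apply: eq_bigr => i _; rewrite mxE exprMn.
Qed.

Lemma enormN v : enorm (- v) = enorm v.
Proof. by rewrite -scaleN1r enormZ normrN1 mul1r. Qed.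

Lemma enorm_coord v i : `|v 0 i| <= enorm v.
Proof.
rewrite -sqrtr_sqr ler_sqrt ?sumr_ge0// => [|j _]; last exact: sqr_ge0.
by rewrite (bigD1 i)//= lerDl sumr_ge0// => j _; exact: sqr_ge0.
Qed.

Lemma enorm_gt0 v : v <> 0 -> 0 < enorm v.
Proof.
move=> v0; rewrite lt_neqAle enorm_ge0 andbT eq_sym; apply/eqP => e0; apply: v0.
by apply/rowP => i; apply/eqP; rewrite mxE -normr_le0 -e0 enorm_coord.
Qed.

(** Cauchy-Schwarz, obtained by expanding the nonnegative sum of the (|v| u_i - |u| v_i)^2 and
    dividing by |u| |v|. *)
Lemma dotr_le u v : `|dotr u v| <= enorm u * enorm v.
Proof.
wlog uv0 : u / 0 <= dotr u v => [H|].
  have [/H//|/ltW uv0] := leP 0 (dotr u v).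
  have dN : dotr (- u) v = - dotr u v.
    by rewrite /dotr -sumrN; apply: eq_bigr => i _; rewrite mxE mulNr.
  by rewrite -(enormN u) -normrN -dN H// dN oppr_ge0.
rewrite ger0_norm//.
have [->|/eqP/enorm_gt0 u0] := eqVneq u 0.
  by rewrite enorm0 mul0r /dotr big1// => i _; rewrite mxE mul0r.
have [->|/eqP/enorm_gt0 v0] := eqVneq v 0.
  by rewrite enorm0 mulr0 /dotr big1// => i _; rewrite mxE mulr0.
have : 0 <= \sum_i (enorm v * u 0 i - enorm u * v 0 i) ^+ 2.
  by apply: sumr_ge0 => i _; exact: sqr_ge0.
have -> : \sum_i (enorm v * u 0 i - enorm u * v 0 i) ^+ 2 =
    enorm v ^+ 2 * dotr u u - enorm u * enorm v * 2 * dotr u v +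
    enorm u ^+ 2 * dotr v v.
  rewrite /dotr !mulr_sumr -sumrB -big_split/=; apply: eq_bigr => i _; ring.
rewrite -!enorm_sqr => H.
rewrite -(@ler_pM2l _ (enorm u * enorm v))// ?mulr_gt0//; nra.
Qed.

Lemma enormD u v : enorm (u + v) <= enorm u + enorm v.
Proof.
rewrite -ler_sqr ?nnegrE ?addr_ge0 ?enorm_ge0// sqrrD !enorm_sqr.
have -> : dotr (u + v) (u + v) = dotr u u + dotr u v *+ 2 + dotr v v.
  rewrite /dotr -sumrMnl -!big_split/=; apply: eq_bigr => i _; rewrite mxE; ring.
rewrite lerD2r lerD2l ler_wMn2r//.
exact: le_trans (ler_norm _) (dotr_le _ _).
Qed.

Lemma enorm_distC x y : enorm (x - y) = enorm (y - x).
Proof. by rewrite -enormN opprB. Qed.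

Lemma enorm_dist x y : `|enorm x - enorm y| <= enorm (x - y).
Proof.
have H (a b : 'rV[R]_d) : enorm a - enorm b <= enorm (a - b).
  by rewrite lerBlDr -{1}(subrK b a) enormD.
by rewrite ler_norml H lerNl opprB enorm_distC H.
Qed.

Lemma mx_norm_le_enorm v : `|v| <= enorm v.
Proof.
rewrite [leLHS]/normr/= mx_normrE; apply: bigmax_le; first exact: enorm_ge0.
by move=> [i j] _; rewrite (ord1 i) enorm_coord.
Qed.

Lemma coord_le_mx_norm v i : `|v 0 i| <= `|v|.
Proof.
by rewrite [leRHS]/normr/= mx_normrE (le_bigmax _ (fun j => `|v j.1 j.2|) (0, i)).
Qed.

Lemma enorm_le_sum v : enorm v <= \sum_i `|v 0 i|.
Proof.
rewrite -ler_sqr ?nnegrE ?enorm_ge0 ?sumr_ge0// enorm_sqr expr2 mulr_suml.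
apply: ler_sum => i _; rewrite -expr2 -real_normK ?num_real// expr2.
apply: ler_wpM2l => //; rewrite (bigD1 i)//= lerDl sumr_ge0//.
Qed.

Lemma enorm_le_mx_norm v : enorm v <= d%:R * `|v|.
Proof.
apply: le_trans (enorm_le_sum v) _.
apply: le_trans (ler_sum _ (fun i _ => coord_le_mx_norm v i)) _.
by rewrite sumr_const card_ord mulr_natl.
Qed.

(** Continuity refers to the sup norm, and [enorm_le_mx_norm] bounds the Euclidean distance by d
    times the sup distance. *)
Lemma enorm_lipschitz_continuous (g : 'rV[R]_d -> R) (L : R) :
  (forall x y, `|g x - g y| <= L * enorm (x - y)) -> continuous g.
Proof.
move=> gL x; apply/(@cvgrPdist_lt _ _ _ (nbhs x) (nbhs_filter x)) => e e0.
(* The summand 1 keeps the denominator positive even if L or d is zero. *)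
have L0 : 0 < `|L| * d%:R + 1 by rewrite ltr_wpDl// mulr_ge0.
apply/nbhs_ballP; exists ((`|L| * d%:R + 1)^-1 * e) => /= [|y].
  by rewrite mulr_gt0 ?invr_gt0.
rewrite -ball_normE/= ltr_pdivlMl// => /(le_lt_trans _); apply.
apply: (@le_trans _ _ (`|L| * (d%:R * `|x - y|))).
  apply: le_trans (gL _ _) (le_trans (ler_wpM2r (enorm_ge0 _) (ler_norm L)) _).
  by rewrite ler_wpM2l ?enorm_le_mx_norm.
by rewrite mulrA ler_wpM2r// lerDl.
Qed.

Lemma enorm_sub_continuous y : continuous (fun z : 'rV[R]_d => enorm (z - y)).
Proof.
apply: (@enorm_lipschitz_continuous _ 1) => x z; rewrite mul1r.
by apply: le_trans (enorm_dist _ _) _; rewrite opprB addrA subrK.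
Qed.

Lemma compact_enorm (A : set 'rV[R]_d) (y : 'rV[R]_d) (r : R) :
  closed A -> A `<=` ecball y r -> compact A.
Proof.
move=> cA Ar; apply: bounded_closed_compact => //.
exists (r + `|y|); split; first exact: num_real.
move=> b rb z /Ar zr; apply: le_trans (ltW rb); rewrite -(subrK y z).
by apply: le_trans (ler_normD _ _) _; rewrite lerD2r (le_trans (mx_norm_le_enorm _)).
Qed.

Lemma closed_ecball (y : 'rV[R]_d) (r : R) : closed (ecball y r).
Proof.
rewrite (_ : ecball y r = (fun z => enorm (z - y)) @^-1` [set t | t <= r])//.
apply: preimage_closed => [z _|]; last exact: closed_le.
exact: enorm_sub_continuous.
Qed.

Lemma compact_esphere (y : 'rV[R]_d) (r : R) : compact (esphere y r).
Proof.
apply: (@compact_enorm _ y r); last by move=> z; rewrite /esphere/ecball/= => ->.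
rewrite (_ : esphere y r = (fun z => enorm (z - y)) @^-1` [set r])//.
apply: preimage_closed => [z _|]; last exact: closed_eq.
exact: enorm_sub_continuous.
Qed.

Lemma compact_ecball (y : 'rV[R]_d) (r : R) : compact (ecball y r).
Proof. by apply: (@compact_enorm _ y r) => //; exact: closed_ecball. Qed.

Lemma open_eball (y : 'rV[R]_d) (r : R) : open (eball y r).
Proof.
rewrite (_ : eball y r = (fun z => enorm (z - y)) @^-1` [set t | t < r])//.
apply: open_comp => [z _|]; last exact: open_lt.
exact: enorm_sub_continuous.
Qed.

(** The sup norm is at most the Euclidean norm, so a Euclidean ball lies in the sup-norm ball of the
    same radius. *)
Lemma nbhs_eball (y : 'rV[R]_d) (A : set 'rV[R]_d) :
  nbhs y A -> exists2 r, 0 < r & eball y r `<=` A.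
Proof.
move=> /nbhs_ballP[r/= r0 rA]; exists r => // z zr; apply: rA.
by rewrite -ball_normE/= (le_lt_trans (mx_norm_le_enorm _))// enorm_distC.
Qed.

Lemma esphere_nonempty (y : 'rV[R]_d) (r : R) : (0 < d)%N -> 0 <= r ->
  esphere y r !=set0.
Proof.
move=> d0 r0; exists (y + r *: delta_mx 0 (Ordinal d0)).
rewrite /esphere/= addrC addKr enormZ ger0_norm//.
rewrite /enorm (bigD1 (Ordinal d0))//= big1 => [|i i0]; last first.
  by rewrite mxE/= (negbTE i0) expr0n.
by rewrite mxE !eqxx expr1n addr0 sqrtr1 mulr1.
Qed.

End euclidean_norm.

(** * Measurability of Lipschitz functions of a random vector *)

Section measurable_lipschitz.
Context {R : realType} {d : nat}.
Implicit Types (x : 'rV[R]_d).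

Lemma rat_approx_enorm x (e : R) : 0 < e ->
  exists q : 'rV[rat]_d, enorm (x - map_mx ratr q) < e.
Proof.
(* The d coordinate errors add up to at most d e / (d + 1) < e; d + 1 also covers dimension 0. *)
move=> e0; pose e' := e / d.+1%:R.
have e'0 : 0 < e' by rewrite divr_gt0.
have /choice[q qP] (i : 'I_d) : exists q : rat, `|x 0 i - ratr q| < e'.
  have [|q] := @rat_in_itvoo R (x 0 i - e') (x 0 i + e').
    by rewrite ltrD2l; lra.
  by rewrite in_itv/= => H; exists q; rewrite ltr_distlC.
exists (\row_i q i); apply: le_lt_trans (enorm_le_sum _) _.
apply: (@le_lt_trans _ _ (\sum_(i < d) e')).
  by apply: ler_sum => i _; rewrite !mxE ltW.
rewrite sumr_const card_ord -mulr_natr mulrAC ltr_pdivrMr//.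
by rewrite ltr_pM2l// ltr_nat.
Qed.

Lemma measurable_enorm_sub d' (T : measurableType d') (X : T -> 'rV[R]_d) x :
  (forall i, measurable_fun [set: T] (fun t => X t 0 i)) ->
  measurable_fun [set: T] (fun t => enorm (X t - x)).
Proof.
move=> mX; apply: (@measurableT_comp _ _ _ _ _ _ (@Num.sqrt R)).
  by apply: continuous_measurable_fun; exact: sqrt_continuous.
apply: measurable_sum => i; apply: measurable_funX.
under eq_fun do rewrite !mxE.
exact: measurable_funB.
Qed.

(* {g < a} is the union, over rational points q, of the balls
   {x | g q + L |x - q| < a}. *)
Lemma measurable_lipschitz d' (T : measurableType d') (X : T -> 'rV[R]_d)
    (g : 'rV[R]_d -> R) (L : R) :
  (forall i, measurable_fun [set: T] (fun t => X t 0 i)) -> 0 < L ->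
  (forall x y, `|g x - g y| <= L * enorm (x - y)) ->
  measurable_fun [set: T] (g \o X).
Proof.
move=> mX L0 gL; apply: (measurability _ (RGenInftyO.measurableE R)).
move=> _ [_ [a ->] <-]; rewrite setTI.
have -> : (g \o X) @^-1` `]-oo, a[ = \bigcup_(q : 'rV[rat]_d)
    [set t | enorm (X t - map_mx ratr q) < (a - g (map_mx ratr q)) / L].
  apply/seteqP; split => [t /=|t [q _]/=]; rewrite in_itv/=.
    (* The factor 2 pays twice for the Lipschitz error: g q + L |X t - q| <= g (X t) + 2 L |X t - q|
       < a. *)
    move=> ga; have [|q qP] := @rat_approx_enorm (X t) ((a - g (X t)) / (2 * L)).
      by rewrite divr_gt0 ?subr_gt0 ?mulr_gt0.
    exists q => //=; rewrite ltr_pdivlMr//.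
    move: qP; rewrite ltr_pdivlMr ?mulr_gt0//.
    have := gL (X t) (map_mx ratr q); rewrite ler_norml => /andP[]; lra.
  rewrite ltr_pdivlMr// => H.
  have := gL (X t) (map_mx ratr q); rewrite ler_norml => /andP[]; lra.
apply: countable_bigcupT_measurable => [|q]; first exact: countableP.
rewrite [X in measurable X](_ : _ =
    (fun t => enorm (X t - map_mx ratr q)) @^-1` `]-oo, (a - g (map_mx ratr q)) / L[).
  by rewrite -[X in measurable X]setTI; apply: measurable_enorm_sub.
by apply/seteqP; split => t /=; rewrite in_itv.
Qed.

End measurable_lipschitz.

(** * Standard Gaussian vectors *)

Section gaussian_vector.
Context {R : realType} {d : nat}.
Implicit Types (mu x : 'rV[R]_d) (sigma a : R) (g : 'rV[R]_d -> R).
Local Notation T := (d.-tuple (measurableTypeR R)).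
Local Notation std := (@gauss R d 0 1).

Definition tuple_row (t : T) : 'rV[R]_d := \row_i tnth t i.

Lemma measurable_tuple_row i : measurable_fun [set: T] (fun t => tuple_row t 0 i : R).
Proof. by under eq_fun do rewrite mxE; exact: measurable_tnth. Qed.

Lemma gauss_expectationE mu sigma g :
  gauss_expectation mu sigma g =
  fine (\int[gauss mu sigma]_t (g (tuple_row t))%:E)%E.
Proof. by rewrite /gauss_expectation [in LHS]unlock. Qed.

Lemma gauss_expectation_affine mu sigma g : 0 < sigma ->
  measurable_fun [set: T] (g \o tuple_row) -> (forall x, 0 <= g x) ->
  gauss_expectation mu sigma g =
  gauss_expectation 0 1 (fun x => g (mu + sigma *: x)).
Proof.
move=> sigma0 mg g0; rewrite !gauss_expectationE; apply: (congr1 fine).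
have mh (i : 'I_d) : measurable_fun [set: measurableTypeR R]
    ((fun u : R => mu 0 i + sigma * u) : measurableTypeR R -> measurableTypeR R).
  by apply: measurable_funD => //; exact: measurable_funM.
rewrite (@ge0_integral_tuple_prob_map _ _ _ (measurableTypeR R) (measurableTypeR R) d
  (fun i => normal_prob (mu 0 i) sigma) (fun i => normal_prob ((0 : 'rV[R]_d) 0 i) 1)
  (fun i (u : R) => mu 0 i + sigma * u)).
- apply: eq_integral => t _ /=; congr (g _)%:E.
  by apply/rowP => i; rewrite !mxE tnth_mktuple.
- exact: mh.
- by move=> i A mA; rewrite mxE; exact: normal_prob_affine.
- by apply/measurable_EFinP.
- by move=> t; rewrite lee_fin.
Qed.

(** The integrand times the standard density is tau times the density of N(0, tau^2). With lambda =
    (1 - tau^-2) / 2, this is the moment E exp (lambda x^2) = (1 - 2 lambda)^(-1/2). *)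
Lemma normal_prob_exp_square (tau : R) : 0 < tau ->
  (\int[(normal_prob 0 1 : probability (measurableTypeR R) R)]_x
     (expR ((1 - tau ^- 2) / 2 * x ^+ 2))%:E = tau%:E)%E.
Proof.
move=> tau0; rewrite ge0_integral_normal_prob//; last first.
  apply/measurable_EFinP/measurableT_comp => //.
  by apply: measurable_funM => //; exact: measurable_funX.
transitivity (\int[lebesgue_measure]_x (tau%:E * (normal_pdf 0 tau x)%:E))%E.
  apply: eq_integral => x _; rewrite -!EFinM; congr EFin.
  rewrite !normal_pdfE ?gt_eqF// /normal_peak /normal_fun.
  have -> : tau ^+ 2 * pi *+ 2 = tau ^+ 2 * (1 ^+ 2 * pi *+ 2).
    by rewrite expr1n mul1r mulrnAr.
  rewrite sqrtrM ?sqr_ge0// sqrtr_sqr gtr0_norm//.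
  have : 0 < Num.sqrt (1 ^+ 2 * pi *+ 2) :> R.
    by rewrite sqrtr_gt0 expr1n mul1r mulrn_wgt0 ?pi_gt0.
  set D := Num.sqrt _ => D0.
  have -> : - (x - 0) ^+ 2 / (tau ^+ 2 *+ 2) =
      (1 - tau ^- 2) / 2 * x ^+ 2 + - (x - 0) ^+ 2 / (1 ^+ 2 *+ 2).
    by field; lra.
  by rewrite expRD; field; lra.
rewrite ge0_integralZl//.
- by rewrite integral_normal_pdf mule1.
- by apply/measurable_EFinP; exact: measurable_normal_pdf.
- by move=> x _; rewrite lee_fin normal_pdf_ge0.
- by rewrite lee_fin ltW.
Qed.

Lemma gauss_tail a : (0 < d)%N -> Num.sqrt d%:R < a ->
  (std [set t | (a <= enorm (tuple_row t))%R] <=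
   (expR (- (a - Num.sqrt d%:R) ^+ 2 / 2))%:E)%E.
Proof.
move=> d0; set q := Num.sqrt d%:R => qa.
have q0 : 0 < q by rewrite sqrtr_gt0 ltr0n.
have qq : q ^+ 2 = d%:R by rewrite sqr_sqrtr.
have a0 : 0 < a by lra.
(* Chernoff exponent lambda = (1 - d / a^2) / 2, the minimizer of
   (1 - 2 lambda)^(- d / 2) exp (- lambda a^2). *)
pose tau := a / q; have tau0 : 0 < tau by rewrite divr_gt0.
pose lambda := (1 - tau ^- 2) / 2.
have lambda_ge0 : 0 <= lambda.
  rewrite divr_ge0// subr_ge0 invf_le1 ?exprn_gt0// expr_ge1 ?ltW// /tau.
  by rewrite ltr_pdivlMr// mul1r.
pose w (t : T) := \prod_i expR (lambda * tnth t i ^+ 2).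
have w_ge0 t : 0 <= w t by apply: prodr_ge0 => i _; exact: expR_ge0.
have mexp : measurable_fun [set: measurableTypeR R]
    (fun u => expR (lambda * u ^+ 2) : measurableTypeR R).
  by apply: measurableT_comp => //; apply: measurable_funM => //;
    exact: measurable_funX.
have mw : measurable_fun [set: T] w.
  apply: measurable_prod => i _.
  exact: measurableT_comp mexp (measurable_tnth _).
have menorm : measurable_fun [set: T] (fun t => enorm (tuple_row t)).
  have := measurable_enorm_sub 0 measurable_tuple_row.
  by under eq_fun do rewrite subr0.
set B := [set t | _].
have mB : measurable B.
  rewrite [X in measurable X](_ : _ = (fun t => enorm (tuple_row t)) @^-1` `[a, +oo[).
    by rewrite -[X in measurable X]setTI; exact: menorm.
  by apply/seteqP; split => t /=; rewrite in_itv/= andbT.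
have wE t : w t = expR (lambda * enorm (tuple_row t) ^+ 2).
  rewrite /w -expR_sum -mulr_sumr enorm_sqr; congr (expR (_ * _)).
  by apply: eq_bigr => i _; rewrite mxE expr2.
rewrite -(setIT B) -integral_indic//.
(* Markov's step: the indicator of |t| >= a is at most exp (lambda (|t|^2 - a^2)). *)
apply: (@le_trans _ _ (\int[std]_t ((expR (- (lambda * a ^+ 2)))%:E * (w t)%:E))%E).
  apply: ge0_le_integral => //.
  - by apply/measurable_EFinP; exact: measurable_indic.
  - by apply/measurable_EFinP; exact: measurable_funM.
  - move=> t _; rewrite -EFinM lee_fin wE -expRD indicE.
    case: (boolP (t \in B)) => [|_]; last exact: expR_ge0.
    rewrite inE /B/= => at_; rewrite -[leLHS]expR0 ler_expR addrC subr_ge0.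
    by rewrite ler_wpM2l// ler_sqr ?nnegrE ?enorm_ge0// ltW.
rewrite ge0_integralZl//; [|exact/measurable_EFinP|]; last first.
  by move=> t _; rewrite lee_fin.
have -> : (\int[std]_t (w t)%:E = \prod_(i < d) tau%:E)%E.
  rewrite (integral_tuple_prob_prod _ (fun=> mexp))//.
  by apply: eq_bigr => i _; rewrite mxE normal_prob_exp_square.
rewrite prodEFin prodr_const card_ord -EFinM lee_fin.
have tauE : tau = 1 + (a - q) / q by rewrite /tau; field; lra.
(* Bound tau^d through tau <= exp (tau - 1). Since lambda a^2 = (a^2 - q^2) / 2 and d (a - q) / q =
   q (a - q), the total exponent is exactly - (a - q)^2 / 2. *)
apply: (@le_trans _ _ (expR (- (lambda * a ^+ 2)) * expR (d%:R * ((a - q) / q)))).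
  rewrite ler_wpM2l ?expR_ge0// expRM_natl lerXn2r ?nnegrE ?expR_ge0 ?(ltW tau0)//.
  by rewrite tauE expR_ge1Dx.
rewrite -expRD ler_expR le_eqVlt; apply/orP; left; apply/eqP.
by rewrite -qq /lambda /tau; field; lra.
Qed.

End gaussian_vector.

(** * Differential calculus *)

Section calculus.
Context {R : realType}.

(** The difference quotients of t |-> g (a + t v) at s are literally those of g at a + s v along
    v. *)
Lemma is_derive_line {V W : normedModType R} (g : V -> W) (a v : V) (s : R)
    (dg : W) :
  is_derive (a + s *: v) v g dg ->
  is_derive s (1 : R) (fun t : R => g (a + t *: v)) dg.
Proof.
move=> [cvg_g derive_g].
pose q t := t^-1 *: ((g \o shift (a + s *: v)) (t *: v) - g (a + s *: v)).
have qE : (fun t : R => t^-1 *: (((fun t : R => g (a + t *: v)) \o shift s) t%:A -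
    g (a + s *: v))) = q.
  apply/funext => t; rewrite /q/= [_ *: 1]mulr1 scalerDl; congr (_ *: (g _ - _)).
  by rewrite addrCA.
split; last by rewrite -derive_g /derive qE.
by rewrite /derivable qE.
Qed.

Lemma is_derive_MVT (phi phi' : R -> R) (a b : R) :
  (forall s : R, is_derive s (1 : R) phi (phi' s)) -> a < b ->
  exists c, [/\ a < c, c < b & phi b - phi a = phi' c * (b - a)].
Proof.
move=> dphi ab.
have cphi : {within `[a, b], continuous phi}.
  apply: derivable_within_continuous => x _.
  by case: (dphi x).
have [c] := MVT ab (fun x _ => dphi x) cphi.
by rewrite in_itv/= => /andP[ac cb] phiE; exists c.
Qed.

(** The mean value theorem on each half gives slopes phi' a and phi' b with a < b; applied to phi',
    it shows that the second slope is no larger. *)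
Lemma midpoint_concave (phi phi' phi'' : R -> R) :
  (forall s : R, is_derive s (1 : R) phi (phi' s)) ->
  (forall s : R, is_derive s (1 : R) phi' (phi'' s)) ->
  (forall s, 0 <= s <= 1 -> phi'' s <= 0) ->
  (phi 0 + phi 1) / 2 <= phi (1 / 2).
Proof.
move=> dphi dphi' phi''_le0.
have [|a [a0 a1 Ea]] := is_derive_MVT (a := 0) (b := 1 / 2) dphi; first lra.
have [|b [b0 b1 Eb]] := is_derive_MVT (a := 1 / 2) (b := 1) dphi; first lra.
have [|c [c0 c1 Ec]] := is_derive_MVT (a := a) (b := b) dphi'; first lra.
have := phi''_le0 c; rewrite (_ : 0 <= c <= 1) => [/(_ isT) H|]; last first.
  by apply/andP; split; lra.
have : phi'' c * (b - a) <= 0 by rewrite mulr_le0_ge0//; lra.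
rewrite -Ec; lra.
Qed.

(** Subtracting K s^2 / 2 reduces to the concave case; this parabola accounts for the K / 8. *)
Lemma midpoint_ge (phi phi' phi'' : R -> R) (K : R) :
  (forall s : R, is_derive s (1 : R) phi (phi' s)) ->
  (forall s : R, is_derive s (1 : R) phi' (phi'' s)) ->
  (forall s, 0 <= s <= 1 -> phi'' s <= K) ->
  (phi 0 + phi 1) / 2 - K / 8 <= phi (1 / 2).
Proof.
move=> dphi dphi' phiK.
have dsq (s : R) : is_derive s (1 : R) (fun s : R => K / 2 * (s * s)) (K * s).
  have dss := is_deriveM (is_derive_id s (1 : R)) (is_derive_id s (1 : R)).
  by apply: (is_derive_eq (is_deriveZ (K / 2) dss)); rewrite /GRing.scale/=; field.
have dlin (s : R) : is_derive s (1 : R) (fun s : R => K * s) K.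
  apply: (is_derive_eq (is_deriveZ K (is_derive_id s (1 : R)))).
  by rewrite /GRing.scale/= mulr1.
have phi''K s : 0 <= s <= 1 -> phi'' s - K <= 0 by move/phiK; rewrite subr_le0.
have := midpoint_concave (fun s => is_deriveB (dphi s) (dsq s))
  (fun s => is_deriveB (dphi' s) (dlin s)) phi''K.
by rewrite !fctE; lra.
Qed.

End calculus.

(** * Directional derivatives and bounds on quadratic forms *)

Section gradient_hessian.
Context {R : realType} {d : nat}.
Implicit Types (f : 'rV[R]_d -> R) (x v w : 'rV[R]_d) (A : 'M[R]_d).

Lemma is_derive_grad f x v : differentiable f x ->
  is_derive x v f (dotr (grad f x) v).
Proof.
move=> df; apply: DeriveDef; first exact: diff_derivable.
rewrite deriveE// {1}(row_sum_delta v) linear_sum; apply: eq_bigr => i _.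
by rewrite linearZ mxE deriveE// mulrC.
Qed.

Lemma is_derive_hess f x v w : differentiable (grad f) x ->
  is_derive x v (fun y => dotr (grad f y) w) ((v *m hess f x *m w^T) 0 0).
Proof.
move=> dg; have dgv : derivable (grad f) x v by exact: diff_derivable.
have coordP i : is_derive x v (fun y => grad f y 0 i) ((v *m hess f x) 0 i).
  apply: DeriveDef; first by move/derivable_mxP : dgv; exact.
  by rewrite -(deriveEjacobian _ dg) derive_mx// mxE.
have dsum := is_derive_sum (fun i => is_deriveZ (w 0 i) (coordP i)).
rewrite (_ : (fun y => _) = \sum_i w 0 i \*: (fun y => grad f y 0 i)); last first.
  by apply/funext => y; rewrite fct_sumE; apply: eq_bigr => i _; rewrite mulrC.
apply: (is_derive_eq dsum); rewrite mxE; apply: eq_bigr => i _.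
by rewrite [w^T _ _]mxE [RHS]mulrC.
Qed.

Lemma spectral_norm_ge A v : enorm (v *m A^T) <= spectral_norm A * enorm v.
Proof.
have [->|/eqP/enorm_gt0 v0] := eqVneq v 0; first by rewrite mul0mx enorm0 mulr0.
rewrite -ler_pdivrMr//.
have -> : enorm (v *m A^T) / enorm v = enorm (((enorm v)^-1 *: v) *m A^T).
  by rewrite -scalemxAl enormZ ger0_norm ?invr_ge0 ?enorm_ge0// mulrC.
apply: ub_le_sup; last first.
  exists ((enorm v)^-1 *: v) => //=.
  by rewrite enormZ ger0_norm ?invr_ge0 ?enorm_ge0// mulVf ?gt_eqF.
(* The supremum bounds its elements only once the set is known to be bounded; coordinates of a unit
   vector are at most 1 in absolute value. *)
exists (\sum_i \sum_j `|A i j|) => _ [w w1 <-].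
apply: le_trans (enorm_le_sum _) _; apply: ler_sum => i _.
rewrite mxE; apply: le_trans (ler_norm_sum _ _ _) _; apply: ler_sum => j _.
by rewrite mxE normrM ler_piMl// -[leRHS]w1 enorm_coord.
Qed.

Lemma quadratic_form_le A v :
  (v *m A *m v^T) 0 0 <= spectral_norm A * enorm v ^+ 2.
Proof.
have -> : (v *m A *m v^T) 0 0 = dotr v (v *m A^T).
  rewrite -dotrE /dotr.
  under eq_bigr do rewrite mxE mulr_suml.
  rewrite exchange_big/=; apply: eq_bigr => i _.
  by rewrite [in RHS]mxE mulr_sumr; apply: eq_bigr => j _; rewrite mxE; ring.
apply: le_trans (ler_norm _) (le_trans (dotr_le _ _) _).
by rewrite expr2 mulrA [leRHS]mulrC ler_wpM2l ?enorm_ge0 ?spectral_norm_ge.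
Qed.

End gradient_hessian.

(** * Restrictions of f and f_N to lines *)

Section smooth_function.
Context {R : realType} {d : nat}.
Implicit Types (f : 'rV[R]_d -> R) (x y v : 'rV[R]_d) (N K L r : R).

Lemma is_derive_fline f x v (s : R) : (forall x, differentiable f x) ->
  is_derive s (1 : R) (fun s : R => f (x + s *: v)) (dotr (grad f (x + s *: v)) v).
Proof. by move=> df; apply: is_derive_line; exact: is_derive_grad. Qed.

Lemma is_derive_gradline f x v (s : R) : (forall x, differentiable (grad f) x) ->
  is_derive s (1 : R) (fun s : R => dotr (grad f (x + s *: v)) v)
    ((v *m hess f (x + s *: v) *m v^T) 0 0).
Proof.
move=> dg; apply: (@is_derive_line _ _ _ (fun y => dotr (grad f y) v)).
exact: is_derive_hess.
Qed.

(** The expression bounded by K is the second derivative of s |-> f_N (x + s v), so [midpoint_ge]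
    applies. *)
Lemma fpow_midpoint_ge N f x v K : twice_cont_diff f ->
  (forall s, 0 <= s <= 1 -> let z := x + s *: v in
    N * fpow N f z * (N * dotr (grad f z) v ^+ 2 + (v *m hess f z *m v^T) 0 0) <= K) ->
  (fpow N f x + fpow N f (x + v)) / 2 - K / 8 <= fpow N f (x + (1 / 2) *: v).
Proof.
move=> [df dg _] HK.
pose phi (s : R) := fpow N f (x + s *: v).
pose g1 (s : R) := dotr (grad f (x + s *: v)) v.
pose g2 (s : R) := (v *m hess f (x + s *: v) *m v^T) 0 0.
have dN (s : R) : is_derive s (1 : R) (fun s : R => N * f (x + s *: v)) (N * g1 s).
  exact: (is_deriveZ N (is_derive_fline x v s df)).
have dphi (s : R) : is_derive s (1 : R) phi (phi s * (N * g1 s)).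
  exact: (is_derive1_comp (is_derive_expR _) (dN s)).
have dphi' (s : R) : is_derive s (1 : R) (fun s => phi s * (N * g1 s))
    (N * phi s * (N * g1 s ^+ 2 + g2 s)).
  have dg1 := is_deriveZ N (is_derive_gradline x v s dg).
  apply: (is_derive_eq (is_deriveM (dphi s) dg1)).
  rewrite -[LHS]/(phi s * (N * g2 s) + N * g1 s * (phi s * (N * g1 s))); ring.
have := midpoint_ge dphi dphi' HK.
by rewrite /phi scale0r scale1r addr0.
Qed.

(** Along v = grad f x the derivative is |v|^2, while the difference quotients are at most L |v|. *)
Lemma enorm_grad_le f x L : differentiable f x -> 0 <= L ->
  (forall y z, `|f y - f z| <= L * enorm (y - z)) -> enorm (grad f x) <= L.
Proof.
move=> df L0 fL; set v := grad f x.
have [vcvg dv] := is_derive_grad v df.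
have gL : dotr v v <= L * enorm v.
  rewrite -dv; apply: limr_le => //; near=> h.
  have h0 : h != 0 by near: h; exact: nbhs_dnbhs_neq.
  apply: le_trans (ler_norm _) _; rewrite normrM normfV ler_pdivrMl ?normr_gt0//=.
  by apply: le_trans (fL _ _) _; rewrite addrK enormZ mulrCA.
have [->|/eqP/enorm_gt0 v0] := eqVneq v 0; first by rewrite enorm0.
by move: gL; rewrite -enorm_sqr expr2 ler_pM2r.
Unshelve. all: by end_near. Qed.

(** Along its own gradient v, f has derivative |v|^2 at y, which must vanish at an interior maximum
    on the line. *)
Lemma grad_local_max f y : (forall x, differentiable f x) ->
  (\forall x \near y, f x <= f y) -> grad f y = 0.
Proof.
move=> df fy; apply: contrapT => /[dup] g0 /enorm_gt0 gp; set v := grad f y in g0 gp.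
have [r r0 yr] := nbhs_eball fy.
pose e := r / enorm v; have e0 : 0 < e by rewrite divr_gt0.
have inr t : t \in `](- e), e[%R -> f (y + t *: v) <= f y.
  rewrite in_itv/= => te; apply: yr; rewrite /eball/= addrC addKr enormZ.
  by rewrite -ltr_pdivlMr// ltr_norml.
have dline (t : R) : is_derive t (1 : R) (fun t : R => f (y + t *: v))
    (dotr (grad f (y + t *: v)) v).
  exact: is_derive_fline.
have e00 : (0 : R) \in `](- e), e[%R by rewrite in_itv/= oppr_lt0 e0.
have [_ d0] : is_derive (0 : R) (1 : R) (fun t : R => f (y + t *: v)) (0 : R).
  apply: (@derive1_at_max _ _ (- e) e) => //; first lra.
  by move=> t /inr; rewrite scale0r addr0.
have [_] := dline 0; rewrite d0 scale0r addr0 -enorm_sqr => /esym/eqP.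
by rewrite expf_eq0/= gt_eqF.
Qed.

(** Two mean value steps along v = x - y express f x - f y as a positive multiple of the Hessian
    form of v at a point between y and x. This will make Delta positive. *)
Lemma concave_lt_max f y x r : twice_cont_diff f -> grad f y = 0 ->
  (forall v z, v <> 0 -> eball y r z -> (v *m hess f z *m v^T) 0 0 < 0) ->
  eball y r x -> x <> y -> f x < f y.
Proof.
move=> [df dg _] gy0 fc xr xy; pose v := x - y.
have v0 : v <> 0 by move/eqP; rewrite subr_eq0 => /eqP.
have [c [c0 c1 Ec]] := is_derive_MVT (fun s => is_derive_fline y v s df) ltr01.
have [b [b0 bc Eb]] := is_derive_MVT (fun s => is_derive_gradline y v s dg) c0.
move: Ec Eb; rewrite !scale0r !scale1r !addr0 gy0 !subr0 mulr1.
rewrite {1}/v (addrC y) subrK => Ec.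
have -> : dotr (0 : 'rV[R]_d) v = 0 by rewrite /dotr big1// => i _; rewrite mxE mul0r.
rewrite subr0 -Ec => Eb.
rewrite -subr_lt0 Eb pmulr_llt0//; apply: fc => //.
rewrite /eball/= addrC addKr enormZ gtr0_norm//.
apply: le_lt_trans xr; rewrite ler_piMl ?enorm_ge0//; lra.
Qed.

(** From 1 + t <= exp t, f_N y - f_N z <= f_N y * N (f y - f z), and f_N y <= exp (N K); exchanging
    y and z gives the absolute value. *)
Lemma fpow_lipschitz N f K L : 0 < N -> (forall x, f x <= K) ->
  (forall y z, `|f y - f z| <= L * enorm (y - z)) ->
  forall y z, `|fpow N f y - fpow N f z| <= expR (N * K) * N * L * enorm (y - z).
Proof.
move=> N0 fK fL.
have H y z : fpow N f y - fpow N f z <= expR (N * K) * N * L * enorm (y - z).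
  rewrite /fpow; apply: (@le_trans _ _ (expR (N * f y) * (N * (f y - f z)))).
    have := expR_ge1Dx (N * (f z - f y)).
    have -> : expR (N * f z) = expR (N * f y) * expR (N * (f z - f y)).
      by rewrite -expRD; congr expR; ring.
    have := expR_gt0 (N * f y); nra.
  have := fL y z; rewrite ler_norml => /andP[_ fyz].
  apply: (@le_trans _ _ (expR (N * f y) * (N * (L * enorm (y - z))))).
    by rewrite ler_wpM2l ?expR_ge0// ler_wpM2l// ltW.
  rewrite -!mulrA; apply: ler_wpM2r.
    by rewrite mulr_ge0 ?(ltW N0)// (le_trans _ (fL y z)).
  by rewrite ler_expR ler_wpM2l ?(ltW N0).
move=> y z; rewrite ler_norml H lerNl opprB andbT (le_trans (H _ _))//.
by rewrite enorm_distC.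
Qed.

End smooth_function.

(** * Smoothing *)

Section smoothing.
Context {R : realType} {d : nat} {d' : measure_display} {T : measurableType d'}.
Context (P : probability T R) (X : T -> 'rV[R]_d) (g : 'rV[R]_d -> R).
Context (L K sigma : R).
Context (mX : forall i, measurable_fun [set: T] (fun t => X t 0 i)).
Context (L_gt0 : 0 < L).
Context (g_lip : forall x y, `|g x - g y| <= L * enorm (x - y)).
Context (g_bounded : forall x, `|g x| <= K).
Context (sigma_gt0 : 0 < sigma).
Implicit Types (x y v : 'rV[R]_d).

(** The noise law is independent of x, so values at different points are compared under one
    integral; X will be the standard Gaussian vector. *)
Definition smoothed x : R := \int[P]_t g (x + sigma *: X t).

Lemma smoothed_integrable x :
  P.-integrable [set: T] (EFin \o (fun t => g (x + sigma *: X t))).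
Proof.
apply: measurable_bounded_integrable => //.
- by apply: le_lt_trans (ltry 1); rewrite probability_le1.
- apply: (@measurable_lipschitz _ _ _ _ X (fun z => g (x + sigma *: z))
    (L * sigma)) => //.
    exact: mulr_gt0.
  move=> y z; apply: le_trans (g_lip _ _) _.
  by rewrite opprD addrACA subrr add0r -scalerBr enormZ gtr0_norm// mulrA.
- exists K; split; first exact: num_real.
  by move=> b Kb t _ /=; exact: le_trans (g_bounded _) (ltW Kb).
Qed.

Lemma Rintegral_probability_cst (c : R) : \int[P]_t c = c.
Proof.
rewrite Rintegral_cst// -[RHS]mulr1; congr (_ * _).
exact: (congr1 fine (probability_setT P)).
Qed.

(** Both points receive the same noise, which cancels in the difference. *)
Lemma smoothed_lipschitz x y : `|smoothed x - smoothed y| <= L * enorm (x - y).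
Proof.
have ix := smoothed_integrable x; have iy := smoothed_integrable y.
rewrite -RintegralB//; apply: le_trans (le_normr_Rintegral _ _) _ => //.
  exact: (integrableB _ ix iy).
rewrite -[leRHS]Rintegral_probability_cst; apply: le_Rintegral => //.
- by apply: integrable_norm; exact: (integrableB _ ix iy).
- exact: finite_measure_integrable_cst.
- move=> t _; apply: le_trans (g_lip _ _) _.
  by rewrite opprD addrACA subrr addr0.
Qed.

Lemma smoothed_dist x :
  P.-integrable [set: T] (EFin \o (fun t => enorm (X t))) ->
  `|smoothed x - g x| <= L * sigma * \int[P]_t enorm (X t).
Proof.
move=> iX; have ix := smoothed_integrable x.
have ic : P.-integrable [set: T] (EFin \o cst (g x)).
  exact: finite_measure_integrable_cst.
rewrite -[X in _ - X]Rintegral_probability_cst -RintegralB//.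
apply: le_trans (le_normr_Rintegral _ _) _ => //; first exact: (integrableB _ ix ic).
rewrite -RintegralZl//; apply: le_Rintegral => //.
- by apply: integrable_norm; exact: (integrableB _ ix ic).
- exact: (integrableZl _ _ iX).
- move=> t _; apply: le_trans (g_lip _ _) _.
  by rewrite addrC addKr enormZ gtr0_norm// mulrA.
Qed.

(** The pointwise midpoint defect is at least K1 - (K1 + K2) 1_B, where B is the event of large
    noise. Its integral is at least K1 - (K1 + K2) p > 0. *)
Lemma smoothed_midpoint_lt x v (a K1 K2 p : R) :
  0 <= K1 -> 0 <= K2 -> (P [set t | (a <= enorm (X t))%R] <= p%:E)%E ->
  (forall t, enorm (X t) < a ->
    (g (x + sigma *: X t) + g (x + v + sigma *: X t)) / 2 + K1 <=
    g (x + (1 / 2) *: v + sigma *: X t)) ->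
  (forall t,
    (g (x + sigma *: X t) + g (x + v + sigma *: X t)) / 2 - K2 <=
    g (x + (1 / 2) *: v + sigma *: X t)) ->
  (K1 + K2) * p < K1 ->
  (smoothed x + smoothed (x + v)) / 2 < smoothed (x + (1 / 2) *: v).
Proof.
move=> K1_ge0 K2_ge0; set B := [set t | _] => PB near far Kp.
have mB : measurable B.
  have menorm := measurable_enorm_sub 0 mX.
  rewrite [X in measurable X](_ : _ = (fun t => enorm (X t - 0)) @^-1` `[a, +oo[).
    by rewrite -[X in measurable X]setTI; exact: menorm.
  by apply/seteqP; split => t /=; rewrite in_itv/= andbT subr0.
have i0 := smoothed_integrable x; have i1 := smoothed_integrable (x + v).
have i2 := smoothed_integrable (x + (1 / 2) *: v).
have i01 : P.-integrable [set: T]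
    (EFin \o (fun t => 1 / 2 * (g (x + sigma *: X t) + g (x + v + sigma *: X t)))).
  exact: (integrableZl _ _ (integrableD _ i0 i1)).
have iB := integrable_indic P mB.
have iK1 := finite_measure_integrable_cst P K1 measurableT.
have ik : P.-integrable [set: T] (EFin \o (fun t => K1 - (K1 + K2) * \1_B t)).
  exact: (integrableB _ iK1 (integrableZl _ (K1 + K2) iB)).
have : \int[P]_t (K1 - (K1 + K2) * \1_B t) <=
    \int[P]_t (g (x + (1 / 2) *: v + sigma *: X t) -
      1 / 2 * (g (x + sigma *: X t) + g (x + v + sigma *: X t))).
  apply: le_Rintegral => //; first exact: (integrableB _ i2 i01).
  move=> t _; rewrite indicE; have [at_|ta] := leP a (enorm (X t)).
    by rewrite mem_set// mulr1; have := far t; lra.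
  rewrite memNset ?mulr0; last by move=> /=; apply/negP; rewrite -ltNge.
  by have := near t ta; lra.
rewrite RintegralB//; [|exact: (integrableZl _ _ iB)].
rewrite [X in _ <= X -> _]RintegralB// !RintegralZl//; last first.
  exact: (integrableD _ i0 i1).
rewrite RintegralD// Rintegral_probability_cst -!/(smoothed _).
have -> : \int[P]_t \1_B t = fine (P B) by rewrite /Rintegral integral_indic// setIT.
have : (K1 + K2) * fine (P B) <= (K1 + K2) * p.
  rewrite ler_wpM2l ?addr_ge0// -lee_fin fineK//; exact: fin_num_measure.
lra.
Qed.

End smoothing.

(** A maximizer z on the closed ball is off the sphere, where F is below F y. If F x >= F z for
    another x in the ball, their midpoint would exceed F z. *)
Lemma unique_max_in_ball (R : realType) d (F : 'rV[R]_d -> R) (y : 'rV[R]_d) (r : R) :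
  0 < r -> continuous F ->
  (forall x, esphere y r x -> F x < F y) ->
  (forall x v, eball y r x -> eball y r (x + v) -> v <> 0 ->
    (F x + F (x + v)) / 2 < F (x + (1 / 2) *: v)) ->
  exists z, eball y r z /\ forall x, eball y r x -> x <> z -> F x < F z.
Proof.
move=> r0 cF Fs Fm.
have ball_center : eball y r y by rewrite /eball/= subrr enorm0.
have [||z] := @EVT_max_rV R d F (ecball y r) _ (@compact_ecball _ _ y r).
- by exists y; exact: ltW ball_center.
- exact: continuous_subspaceT.
rewrite inE => zr Fz.
have {}Fz x : ecball y r x -> F x <= F z by move=> xr; apply: Fz; rewrite inE.
have zb : eball y r z.
  move: (zr); rewrite /ecball/eball/= le_eqVlt => /predU1P[zs|//].
  by have := Fs z zs; rewrite ltNge Fz// /ecball/= ltW.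
exists z; split => // x xb xz; rewrite ltNge; apply/negP => Fzx.
have xzD : x + (z - x) = z by rewrite addrC subrK.
have := Fm x (z - x) xb; rewrite xzD => /(_ zb).
have zx : z - x <> 0 by move/eqP; rewrite subr_eq0 => /eqP /esym.
move=> /(_ zx).
have : F (x + (1 / 2) *: (z - x)) <= F z.
  apply: Fz; rewrite /ecball/=.
  have -> : x + (1 / 2) *: (z - x) - y = (1 / 2) *: (x - y) + (1 / 2) *: (z - y).
    by apply/rowP => i; rewrite !mxE; field.
  apply: le_trans (enormD _ _) _; rewrite !enormZ ger0_norm; last lra.
  by move: xb zb; rewrite /eball/=; lra.
by lra.
Qed.

(** * Choice of R1, positivity of Delta, and the two consequences of the bound on sigma *)

Theorem proposition1 (R : realType) (d : nat) (f : 'rV[R]_d -> R)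
    (ystar : 'rV[R]_d) (R0 m M Lf : R)
    (d_gt0 : (0 < d)%N)
    (f_C2 : twice_cont_diff f)
    (ystar_max : \forall x \near ystar, f x <= f ystar)
    (R0_gt0 : 0 < R0) (m_gt0 : 0 < m) (M_gt0 : 0 < M) (Lf_gt0 : 0 < Lf)
    (f_lip : forall x1 x2, `|f x1 - f x2| <= Lf * enorm (x1 - x2))
    (f_conc : forall v x : 'rV[R]_d, v <> 0 -> eball ystar R0 x ->
      (v *m hess f x *m v^T) 0 0 < - m * enorm v ^+ 2)
    (f_lt : forall x, f x < M)
    (hess_lt : forall x, spectral_norm (hess f x) < M)
    (N : R) (N_gt0 : 0 < N) :
  let small_grad (R1 : R) :=
    [/\ 0 < R1, R1 < R0 &
        sup [set enorm (grad f x) | x in eball ystar R1]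
          < Num.sqrt (m / (2 * N))] in
  (exists R1 : R, small_grad R1) /\
  (forall R1 : R, small_grad R1 ->
   forall r : R, 0 < r -> r < R1 / 2 ->
   forall fc : R, (forall x, ecball ystar R1 x -> fc <= f x) ->
   let m1 := N * expR (N * fc) * (m / 2) in
   let M1 := N ^+ 2 * expR (N * M) * Lf ^+ 2 + N * expR (N * M) * M in
   let Delta := fpow N f ystar - sup [set fpow N f x | x in esphere ystar r] in
   [/\ 0 < m1, 0 < Delta &
    forall sigma : R, 0 < sigma ->
    sigma < Num.min
      (R1 / (2 * Num.sqrt d%:R + 2 * Num.sqrt (2 * ln ((m1 + M1) / m1))))
      (Delta / (2 * expR (N * M) * N * Lf * gauss_expectation 0 1 (@enorm R d))) ->
    exists zstar : 'rV[R]_d, eball ystar r zstar /\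
      forall x, eball ystar r x -> x <> zstar ->
        Fsmooth N sigma f x < Fsmooth N sigma f zstar]).
Proof.
move=> small_grad.
have [f_diff grad_diff _] := f_C2.
have grad0 : grad f ystar = 0 by exact: grad_local_max.
have grad_le x : enorm (grad f x) <= Lf by apply: enorm_grad_le => //; exact: ltW.
have S0 : 0 < Num.sqrt (m / (2 * N)) by rewrite sqrtr_gt0 divr_gt0// mulr_gt0.
split.
  (* Halving the bound leaves room for the supremum, which only inherits a weak inequality. *)
  have : \forall x \near ystar, enorm (grad f x) < Num.sqrt (m / (2 * N)) / 2.
    have cg := differentiable_continuous (grad_diff ystar).
    have nb : nbhs (grad f ystar) (eball (grad f ystar) (Num.sqrt (m / (2 * N)) / 2)).
      apply: open_nbhs_nbhs; split; first exact: open_eball.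
      by rewrite /eball/= subrr enorm0; lra.
    apply: (@filterS _ _ (nbhs_filter ystar) _ _ _ (cg _ nb)) => x.
    by rewrite /eball/= grad0 subr0.
  move=> /nbhs_eball[e e0 eS].
  exists (Num.min e (R0 / 2)); split.
  - by rewrite lt_min e0/=; lra.
  - by rewrite gt_min; apply/orP; right; lra.
  apply: (@le_lt_trans _ _ (Num.sqrt (m / (2 * N)) / 2)); last lra.
  apply: ge_sup.
    exists (enorm (grad f ystar)), ystar => //.
    by rewrite /eball/= subrr enorm0 lt_min e0/=; lra.
  move=> _ [x xe <-]; apply/ltW/eS; apply: lt_le_trans xe _.
  by rewrite ge_min lexx.
move=> R1 [R1_gt0 R1R0 gradR1] r r0 rR1 fc fc_le m1 M1 Delta.
have m1_gt0 : 0 < m1 by rewrite !mulr_gt0// ?expR_gt0 ?invr_gt0.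
have M1_gt0 : 0 < M1.
  by rewrite addr_gt0// !mulr_gt0// ?expR_gt0 ?exprn_gt0.
have fpow_ltM x : fpow N f x <= expR (N * M).
  by rewrite ler_expR ler_wpM2l ?ltW.
(* The gradients are bounded by [Lf], so the supremum is a genuine upper bound. *)
have grad_small z : eball ystar R1 z -> enorm (grad f z) ^+ 2 <= m / (2 * N).
  move=> zR; rewrite -[leRHS]sqr_sqrtr; last by rewrite divr_ge0 ?mulr_ge0// ltW.
  rewrite ler_sqr ?nnegrE ?enorm_ge0 ?(ltW S0)//; apply/ltW.
  apply: le_lt_trans gradR1; apply: ub_le_sup; last by exists z.
  by exists Lf => _ [w _ <-].
set S := [set fpow N f x | x in esphere ystar r].
have S_nonempty : S !=set0 by exact: image_nonempty (esphere_nonempty _ d_gt0 (ltW r0)).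
have fpow_le_sup x : esphere ystar r x -> fpow N f x <= sup S.
  move=> xr; apply: ub_le_sup; last by exists x.
  by exists (expR (N * M)) => _ [w _ <-].
have fpow_lip := fpow_lipschitz N_gt0 (fun x => ltW (f_lt x)) f_lip.
have Delta_gt0 : 0 < Delta.
  have [|c] := @EVT_max_rV R d (fpow N f) (esphere ystar r)
    (esphere_nonempty _ d_gt0 (ltW r0)) (@compact_esphere _ _ _ _).
    by apply: continuous_subspaceT; exact: enorm_lipschitz_continuous fpow_lip.
  rewrite inE => cr cmax; rewrite subr_gt0.
  apply: (@le_lt_trans _ _ (fpow N f c)).
    by apply: ge_sup => // _ [x xr <-]; apply: cmax; rewrite inE.
  rewrite ltr_expR ltr_pM2l//; apply: (concave_lt_max f_C2 grad0 (r := R0)).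
  - move=> v z v0 zR; apply: lt_trans (f_conc v z v0 zR) _.
    by rewrite mulNr oppr_lt0 mulr_gt0// exprn_gt0// enorm_gt0.
  - by rewrite /eball/= cr; lra.
  - by move=> cy; move: cr; rewrite /esphere/= cy subrr enorm0; lra.
split => // sigma sigma0; rewrite lt_min => /andP[sigma_tail sigma_Delta].
set C := expR (N * M) * N * Lf.
have C_gt0 : 0 < C by rewrite !mulr_gt0 ?expR_gt0.
have mX := @measurable_tuple_row R d.
have mfpow : measurable_fun [set: d.-tuple (measurableTypeR R)]
    (fpow N f \o @tuple_row R d).
  exact: measurable_lipschitz mX C_gt0 fpow_lip.
(* Sampling N(x, sigma^2 I) as x + sigma eps with eps standard identifies F_{N,sigma} with this
   F. *)
pose F := smoothed (gauss 0 1) (@tuple_row R d) (fpow N f) sigma.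
have FE x : Fsmooth N sigma f x = F x.
  rewrite /Fsmooth gauss_expectation_affine ?gauss_expectationE//.
  by move=> y; exact: expR_ge0.
have fpow_norm x : `|fpow N f x| <= expR (N * M) by rewrite ger0_norm ?expR_ge0.
have F_lip := smoothed_lipschitz (gauss 0 1) mX C_gt0 fpow_lip fpow_norm sigma0.
suff [z [zr zmax]] : exists z, eball ystar r z /\
    forall x, eball ystar r x -> x <> z -> F x < F z.
  by exists z; split => // x xr xz; rewrite !FE; exact: zmax.
apply: unique_max_in_ball => //.
- exact: enorm_lipschitz_continuous F_lip.
- move=> x xr; set E := gauss_expectation _ _ _ in sigma_Delta.
  have EE : E = fine (\int[@gauss R d 0 1]_t (enorm (tuple_row t))%:E)%E.
    exact: gauss_expectationE.
  have E_ge0 : 0 <= E.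
    by rewrite EE fine_ge0// integral_ge0// => t _; rewrite lee_fin enorm_ge0.
  (* E = 0 would also be the junk value of an infinite expectation, but then
     Delta / 0 = 0 contradicts 0 < sigma; hence E > 0 is the true, finite,
     expectation. *)
  have E_gt0 : 0 < E.
    rewrite lt_neqAle E_ge0 andbT eq_sym; apply/eqP => E0.
    by move: sigma_Delta; rewrite E0 mulr0 invr0 mulr0; lra.
  have iX : (gauss 0 1).-integrable [set: d.-tuple (measurableTypeR R)]
      (EFin \o (fun t => enorm (tuple_row t))).
    apply/integrableP; split.
      apply/measurable_EFinP; have := measurable_enorm_sub 0 mX.
      by under eq_fun do rewrite subr0.
    rewrite ltey; apply/eqP => Eoo; move: E_gt0; rewrite EE.
    rewrite (eq_integral (fun t => `|(enorm (tuple_row t))%:E|%E)); last first.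
      by move=> t _; rewrite gee0_abs// lee_fin enorm_ge0.
    by rewrite Eoo ltxx.
  have F_dist z := smoothed_dist mX C_gt0 fpow_lip fpow_norm sigma0 z iX.
  (* F differs from f_N by less than Delta / 2, both at [ystar] and on the sphere, so the gap Delta
     survives as a strict inequality. *)
  have sC : C * sigma * E * 2 < Delta.
    move: sigma_Delta; rewrite ltr_pdivlMr ?mulr_gt0 ?expR_gt0//.
    by rewrite /C; lra.
  have := F_dist x; have := F_dist ystar; have := fpow_le_sup x xr.
  rewrite -/F.
  have -> : \int[@gauss R d 0 1]_t enorm (tuple_row t) = E by rewrite EE.
  by rewrite !ler_norml => ? /andP[? ?] /andP[? ?]; rewrite /Delta in sC; lra.
move=> x v xr xvr v0.
have e2_gt0 : 0 < enorm v ^+ 2 by rewrite exprn_gt0// enorm_gt0.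
set q := Num.sqrt d%:R in sigma_tail.
set s := Num.sqrt (2 * _) in sigma_tail.
have ratio_gt1 : 1 < (m1 + M1) / m1 by rewrite ltr_pdivlMr// mul1r ltrDl.
have s_gt0 : 0 < s by rewrite sqrtr_gt0 mulr_gt0// ln_gt0.
have q_ge0 : 0 <= q by exact: sqrtr_ge0.
(* The noise sigma eps is shorter than R1 / 2 exactly when |eps| < a. *)
pose a := R1 / (2 * sigma).
have aE : sigma * a = R1 / 2 by rewrite /a; field; lra.
have qsa : q + s < a.
  move: sigma_tail; rewrite /a !ltr_pdivlMr; nra.
have qa : q < a by lra.
(* The constant s is chosen so that exp (- s^2 / 2) = m1 / (m1 + M1), and a - q > s. *)
have Kp : (m1 + M1) * expR (- (a - q) ^+ 2 / 2) < m1.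
  rewrite mulrC -ltr_pdivlMr; last lra.
  apply: (@lt_le_trans _ _ (expR (- s ^+ 2 / 2))); first by rewrite ltr_expR; nra.
  rewrite sqr_sqrtr; last by rewrite mulr_ge0// ln_ge0// ltW.
  have -> : - (2 * ln ((m1 + M1) / m1)) / 2 = - ln ((m1 + M1) / m1) by field.
  by rewrite expRN lnK ?invf_div// posrE; lra.
have quad_le z B1 B2 : enorm (grad f z) ^+ 2 <= B1 ->
    (v *m hess f z *m v^T) 0 0 <= B2 * enorm v ^+ 2 ->
    N * dotr (grad f z) v ^+ 2 + (v *m hess f z *m v^T) 0 0 <=
    (N * B1 + B2) * enorm v ^+ 2.
  move=> gz hz; rewrite mulrDl; apply: lerD => //.
  rewrite -mulrA ler_wpM2l ?(ltW N_gt0)//.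
  apply: (@le_trans _ _ (enorm (grad f z) ^+ 2 * enorm v ^+ 2)).
    rewrite -exprMn -[leLHS]real_normK ?num_real// ler_sqr ?nnegrE ?dotr_le//.
    by rewrite mulr_ge0 ?enorm_ge0.
  by rewrite ler_wpM2r// ltW.
apply: (smoothed_midpoint_lt mX C_gt0 fpow_lip fpow_norm sigma0
  (K1 := m1 * enorm v ^+ 2 / 8) (K2 := M1 * enorm v ^+ 2 / 8) _ _
  (gauss_tail d_gt0 qa)).
- by rewrite divr_ge0// mulr_ge0// ltW.
- by rewrite divr_ge0// mulr_ge0// ltW.
(* Small noise: by convexity the segment stays within r of [ystar] before the shift by w, hence
   within r + R1 / 2 < R1 after it. *)
- move=> t ta; set w := sigma *: tuple_row t.
  have wR : enorm w < R1 / 2 by rewrite /w enormZ gtr0_norm// -aE ltr_pM2l.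
  rewrite (addrAC x v) (addrAC x _ w).
  have := @fpow_midpoint_ge _ _ N f (x + w) v (- (m1 * enorm v ^+ 2)) f_C2.
  rewrite mulNr opprK => H; apply: H => b /andP[b0 b1]; set z := x + w + b *: v.
  have zR : eball ystar R1 z.
    rewrite /eball/= /z.
    have -> : x + w + b *: v - ystar =
        (1 - b) *: (x - ystar) + b *: (x + v - ystar) + w.
      by apply/rowP => i; rewrite !mxE; ring.
    apply: le_lt_trans (enormD _ _) _; apply: (@lt_le_trans _ _ (r + R1 / 2)); last lra.
    apply: ler_ltD => //; apply: le_trans (enormD _ _) _.
    rewrite !enormZ !ger0_norm//; last lra.
    by move: xr xvr; rewrite /eball/=; nra.
  have := quad_le z _ (- m) (grad_small z zR).
  have zR0 : eball ystar R0 z by rewrite /eball/= (lt_trans zR).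
  move=> /(_ (ltW (f_conc v z v0 zR0))).
  (* The gradient bound spends half of the concavity m. As the remaining form is negative, f_N is
     then bounded below, through [fc]. *)
  have -> : N * (m / (2 * N)) - m = - (m / 2) by field; lra.
  have fcz : N * expR (N * fc) <= N * fpow N f z.
    by rewrite ler_pM2l// ler_expR ler_pM2l// fc_le// /ecball/= ltW.
  move=> quad_z; apply: (@le_trans _ _ (N * fpow N f z * (- (m / 2) * enorm v ^+ 2))).
    by rewrite ler_wpM2l// mulr_ge0 ?expR_ge0// ltW.
  rewrite mulNr mulrN lerN2 /m1 -mulrA ler_wpM2r//.
  by rewrite mulr_ge0 ?divr_ge0 ?ltW.
(* Arbitrary noise may leave the ball, so only the global bounds [Lf] and M enter. *)
- move=> t; set w := sigma *: tuple_row t.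
  rewrite (addrAC x v) (addrAC x _ w).
  apply: (@fpow_midpoint_ge _ _ N f (x + w) v (M1 * enorm v ^+ 2)) => // b b01.
  set z := x + w + b *: v.
  have gz : enorm (grad f z) ^+ 2 <= Lf ^+ 2.
    by rewrite ler_sqr ?nnegrE ?enorm_ge0 ?(ltW Lf_gt0).
  have hz : (v *m hess f z *m v^T) 0 0 <= M * enorm v ^+ 2.
    apply: le_trans (quadratic_form_le _ _) _.
    by rewrite ler_wpM2r ?(ltW e2_gt0)// ltW.
  have H := quad_le z _ _ gz hz.
  apply: (@le_trans _ _ (N * expR (N * M) * ((N * Lf ^+ 2 + M) * enorm v ^+ 2))).
    apply: (@le_trans _ _ (N * fpow N f z * ((N * Lf ^+ 2 + M) * enorm v ^+ 2))).
      by rewrite ler_wpM2l// mulr_ge0 ?expR_ge0// ltW.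
    rewrite ler_wpM2r ?ler_wpM2l ?(ltW N_gt0)//.
    rewrite mulr_ge0 ?(ltW e2_gt0)// addr_ge0 ?(ltW M_gt0)//.
    by rewrite mulr_ge0 ?sqr_ge0 ?(ltW N_gt0).
  by rewrite le_eqVlt; apply/orP; left; apply/eqP; rewrite /M1; ring.
- by rewrite -mulrDl -mulrDl; move: Kp e2_gt0; set p := expR _; set e2 := _ ^+ 2; nra.
Qed.
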